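(* Let $\rho\in[1/2,1)$, $0<\varepsilon<1$, and let $Y=Y_\rho$ be the space $\mathbb{R}^2$ equipped with the norm $$\|x\|_\rho=\max\left\{\left|x_1+\left(2-\tfrac1\rho\right)x_2\right|,\ \left|x_2+\left(2-\tfrac1\rho\right)x_1\right|,\ |x_1-x_2|\right\},\qquad x=(x_1,x_2).$$ Then $$\Phi^S(\ell_1^{(2)},Y,\varepsilon)\ge\min\left\{\sqrt{\frac{2\rho\varepsilon}{1-\rho}},\ 1\right\}.$$
   Context: All Banach spaces are real. $\ell_1^{(2)}$ is $\mathbb{R}^2$ with the norm $|x_1|+|x_2|$. $S_X$ denotes the unit sphere of $X$; $L(X,Y)$ is the space of bounded linear operators $X\to Y$ with the operator norm. Spherical Bishop-Phelps-Bollobás modulus: for $\varepsilon\in(0,1)$, $\Phi^S(X,Y,\varepsilon)$ is the infimum of those $\delta>0$ such that for every $(x,T)\in S_X\times S_{L(X,Y)}$ with $\|T(x)\|>1-\varepsilon$ there is $(z,F)\in S_X\times S_{L(X,Y)}$ with $\|F(z)\|=1$, $\|x-z\|<\delta$ and $\|T-F\|<\delta$. *)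

(* Defs.v *)
From HB Require Import structures.
From mathcomp Require Import all_boot all_order all_algebra.
From mathcomp Require Import all_classical all_reals all_analysis.
From mathcomp Require Import ring lra.

Set Implicit Arguments.
Unset Strict Implicit.
Unset Printing Implicit Defensive.

Import Order.TTheory GRing.Theory Num.Theory.
Import numFieldNormedType.Exports.

Local Open Scope classical_set_scope.
Local Open Scope ring_scope.

Section SphericalModulus.
Context {R : realType}.

Definition unit_sphere (X : normedModType R) : set X := [set x | `|x| = 1].

(* The supremum is the operator norm only for bounded operators: on a set
   without upper bound [sup] is 0. *)
Definition opnorm (X Y : normedModType R) (T : X -> Y) : R :=
  sup [set `|T x| | x in [set x : X | `|x| <= 1]].

Definition bounded_operator (X Y : normedModType R) : set {linear X -> Y} :=
  [set T | bounded_fun_norm T].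

Definition operator_sphere (X Y : normedModType R) : set {linear X -> Y} :=
  [set T | bounded_operator T /\ opnorm T = 1].

(* The infimum is over a set bounded below by 0, and nonempty: rank-one
   operators attaining their norm show that it contains every delta > 2. *)
Definition spherical_BPB_modulus (X Y : completeNormedModType R) (eps : R) : R :=
  inf [set delta : R | 0 < delta /\
    forall (x : X) (T : {linear X -> Y}),
      unit_sphere x -> operator_sphere T -> `|T x| > 1 - eps ->
      exists (z : X) (F : {linear X -> Y}),
        [/\ unit_sphere z, operator_sphere F, `|F z| = 1,
            `|x - z| < delta & opnorm (T \- F) < delta]].

End SphericalModulus.

Lemma row2_eq0 (R : nmodType) (x : 'rV[R]_2) : x 0 0 = 0 -> x 0 1 = 0 -> x = 0.
Proof.
move=> x0 x1; apply/rowP => i; rewrite mxE.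
by case: i => -[|[|//]] i; [rewrite -[RHS]x0|rewrite -[RHS]x1];
  congr (x _ _); apply/val_inj.
Qed.

Lemma le_mx_norm_row2 (R : realType) (x : 'rV[R]_2) (c : R) :
  `|x 0 0| <= c -> `|x 0 1| <= c -> `|x| <= c.
Proof.
move=> x0 x1; rewrite [leLHS]/Num.norm/= mx_normrE; apply/bigmax_leP.
split=> [|[i j] _ /=]; first exact: le_trans x0.
rewrite ord1; case: j => -[|[|//]] j.
- by rewrite (_ : Ordinal j = 0)//; apply/val_inj.
- by rewrite (_ : Ordinal j = 1)//; apply/val_inj.
Qed.

Lemma norm_coord_le (R : realType) (x : 'rV[R]_2) i : `|x 0 i| <= `|x|.
Proof.
by rewrite [leRHS]/Num.norm/= mx_normrE; apply/bigmax_geP; right; exists (0, i).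
Qed.

Lemma row2_complete (R : realType) (N : normedModType R)
    (f : N -> 'rV[R]_2) (g : 'rV[R]_2 -> N) :
  {morph f : x y / x - y} -> cancel g f ->
  (forall x i, `|f x 0 i| <= `|x|) ->
  (forall x, `|x| <= `|f x 0 0| + `|f x 0 1|) ->
  forall F : set_system N, ProperFilter F -> cauchy F -> cvg F.
Proof.
move=> fB gK fc fd F FF /cauchy_ballP F_cauchy.
have PF : ProperFilter (f @ F) by exact: fmap_proper_filter.
have : cvg (f @ F).
  apply: cauchy_cvg; apply/cauchy_ballP => e e0.
  have [[A B] /= [FA FB] AB] := F_cauchy _ e0.
  exists (f @` A, f @` B) => /=.
    by split; [apply: filterS FA|apply: filterS FB] => x ?; exists x.
  move=> [_ _] /= [[x Ax <-] [y By <-]].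
  have := AB (x, y) (conj Ax By); rewrite /= -!ball_normE /= => xy.
  by rewrite -fB (le_lt_trans _ xy)// le_mx_norm_row2.
move=> /cvg_ex[l fl]; apply/cvg_ex; exists (g l).
apply/cvgrPdist_lt => e e0.
have e20 : 0 < e / 2 by exact: divr_gt0.
move/cvgrPdist_lt : fl => /(_ _ e20); rewrite near_map.
apply: filterS => x; rewrite -{1}(gK l) -fB => xl.
rewrite (le_lt_trans (fd _))// (splitr e) ltrD// (le_lt_trans _ xl)//;
  exact: norm_coord_le.
Qed.

Section Ell1.
Variable R : realType.

Definition ell1_2 : Type := 'rV[R]_2.
HB.instance Definition _ := GRing.Lmodule.copy ell1_2 'rV[R]_2.

Definition ell1_norm (x : 'rV[R]_2) : R := `|x 0 0| + `|x 0 1|.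

Let ler_norm_add (x y : ell1_2) : ell1_norm (x + y) <= ell1_norm x + ell1_norm y.
Proof. by rewrite /ell1_norm !mxE addrACA lerD ?ler_normD. Qed.

Let norm_scale (l : R) (x : ell1_2) : ell1_norm (l *: x) = `|l| * ell1_norm x.
Proof. by rewrite /ell1_norm !mxE !normrM mulrDr. Qed.

Let norm_eq0 (x : ell1_2) : ell1_norm x = 0 -> x = 0.
Proof.
move=> /eqP; rewrite paddr_eq0// !normr_eq0 => /andP[/eqP x0 /eqP x1].
exact: row2_eq0.
Qed.

HB.instance Definition _ :=
  Lmodule_isNormed.Build R ell1_2 ler_norm_add norm_scale norm_eq0.

Lemma ell1_normE (x : ell1_2) : `|x| = ell1_norm x.
Proof. by []. Qed.

Let complete (F : set_system ell1_2) : ProperFilter F -> cauchy F -> cvg F.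
Proof.
apply: (@row2_complete R ell1_2 id id) => // x i.
rewrite ell1_normE /ell1_norm.
case: i => -[|[|//]] i.
- by rewrite (_ : Ordinal i = 0) ?lerDl//; apply/val_inj.
- by rewrite (_ : Ordinal i = 1) ?lerDr//; apply/val_inj.
Qed.

HB.instance Definition _ := Uniform_isComplete.Build ell1_2 complete.

End Ell1.

Section Yrho.
Variable R : realType.

Definition Yrho_norm (rho : R) (x : 'rV[R]_2) : R :=
  Num.max `|x 0 0 + (2 - rho^-1) * x 0 1|
    (Num.max `|x 0 1 + (2 - rho^-1) * x 0 0| `|x 0 0 - x 0 1|).

(* The hypothesis on rho is part of the type because it is what makes
   [Yrho_norm] separating. *)
Definition Yrho (rho : R) (rho_itv : 2^-1 <= rho < 1) : Type := 'rV[R]_2.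

Variables (rho : R) (rho_itv : 2^-1 <= rho < 1).
Notation Y := (Yrho rho_itv).
HB.instance Definition _ := GRing.Lmodule.copy Y 'rV[R]_2.

Let a_itv : 0 <= 2 - rho^-1 < 1.
Proof.
have /andP[r1 r2] := rho_itv.
have r0 : 0 < rho by lra.
have rV : rho^-1 * rho = 1 by rewrite mulVf// gt_eqF.
have rV0 : 0 < rho^-1 by rewrite invr_gt0.
by apply/andP; split; nra.
Qed.

Let coord_le (x : 'rV[R]_2) :
  `|x 0 0| <= Yrho_norm rho x /\ `|x 0 1| <= Yrho_norm rho x.
Proof.
rewrite /Yrho_norm; have := a_itv; move: (2 - rho^-1) => a /andP[a0 a1].
set m := Num.max _ _.
have : m <= m by [].
rewrite {1}/m !ge_max !ler_norml => /and3P[/andP[? ?] /andP[? ?] /andP[? ?]].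
by clearbody m; split; apply/andP; split; nra.
Qed.

Let ler_norm_add (x y : Y) :
  Yrho_norm rho (x + y) <= Yrho_norm rho x + Yrho_norm rho y.
Proof.
rewrite /Yrho_norm !mxE; move: (2 - rho^-1) => a.
set m := (X in _ <= X + _); set n := (X in _ <= _ + X).
have : m <= m by []; rewrite {1}/m !ge_max => /and3P[m1 m2 m3].
have : n <= n by []; rewrite {1}/n !ge_max => /and3P[n1 n2 n3].
apply/and3P; split.
- by rewrite mulrDr addrACA (le_trans (ler_normD _ _))// lerD.
- by rewrite mulrDr addrACA (le_trans (ler_normD _ _))// lerD.
- by rewrite opprD addrACA (le_trans (ler_normD _ _))// lerD.
Qed.

Let norm_scale (l : R) (x : Y) : Yrho_norm rho (l *: x) = `|l| * Yrho_norm rho x.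
Proof.
rewrite /Yrho_norm !mxE !(mulrCA _ l) -mulrDr -mulrDr -mulrBr !normrM.
by rewrite !maxr_pMr.
Qed.

Let norm_eq0 (x : Y) : Yrho_norm rho x = 0 -> x = 0.
Proof.
move=> x0; have [] := coord_le x; rewrite x0 !normr_le0 => /eqP ? /eqP ?.
exact: row2_eq0.
Qed.

HB.instance Definition _ :=
  Lmodule_isNormed.Build R Y ler_norm_add norm_scale norm_eq0.

Lemma Yrho_normE (x : Y) : `|x| = Yrho_norm rho x.
Proof. by []. Qed.

Let complete (F : set_system Y) : ProperFilter F -> cauchy F -> cvg F.
Proof.
apply: (@row2_complete R Y id id) => // x.
- move=> i; have [x0 x1] := coord_le x; rewrite Yrho_normE.
  case: i => -[|[|//]] i.
  + by rewrite (_ : Ordinal i = 0)//; apply/val_inj.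
  + by rewrite (_ : Ordinal i = 1)//; apply/val_inj.
- rewrite Yrho_normE /Yrho_norm; have := a_itv; move: (2 - rho^-1) => a /andP[a0 a1].
  have aM (t : R) : `|a * t| <= `|t|.
    by rewrite normrM ger0_norm// ler_piMl// ltW.
  rewrite !ge_max; apply/and3P; split.
  + by rewrite (le_trans (ler_normD _ _))// lerD.
  + by rewrite (le_trans (ler_normD _ _))// addrC lerD.
  + by rewrite (le_trans (ler_normB _ _)).
Qed.

HB.instance Definition _ := Uniform_isComplete.Build Y complete.

End Yrho.

(* Main.v *)
(** Put a = 2 - 1/rho. The unit ball of Y is the hexagon with vertices
   +-(1,0), +-(0,1), +-(b,b), where b = 1/(1+a). For delta < 1 take
   x = (1 - delta/2, delta/2), T e1 = (1,0), and let T e2 be the point at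
   distance delta from (b,b) on the edge from (b,b) to (0,1). The functional
   y1 + a y2 is 1 at T e1 and 1 - (1-a) delta at T e2, so that
   |T x| >= 1 - (1-a) delta^2 / 2, which exceeds 1 - eps as soon as
   delta^2 < 2 rho eps / (1 - rho). A unit vector z with |x - z| < delta has
   two positive coordinates, so an F of norm 1 attaining its norm at z maps
   e1 and e2 into a common edge of the hexagon; but no edge meets both open
   delta-balls around T e1 and T e2. *)

Require Import Defs.
From HB Require Import structures.
From mathcomp Require Import all_boot all_order all_algebra.
From mathcomp Require Import all_classical all_reals all_analysis.
From mathcomp Require Import ring lra.

Import Order.TTheory GRing.Theory Num.Theory.
Import numFieldNormedType.Exports.

Local Open Scope ring_scope.

(** * Estimates for the operator norm and the operator sphere *)

Section OperatorNorm.
Context {R : realType} {X Y : normedModType R}.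

(** The bound [M] ensures that [opnorm T] is a genuine supremum rather than the default value 0. *)
Lemma opnorm_ub (T : X -> Y) (M : R) (v : X) :
  (forall u, `|u| <= 1 -> `|T u| <= M) -> `|v| <= 1 -> `|T v| <= opnorm T.
Proof.
move=> TM v1; apply: ub_le_sup; last by exists v.
by exists M => _ /= [u u1 <-]; exact: TM.
Qed.

Lemma opnorm_le (T : X -> Y) (M : R) :
  (forall u, `|u| <= 1 -> `|T u| <= M) -> opnorm T <= M.
Proof.
move=> TM; apply: ge_sup; first by exists `|T 0|, 0 => //=; rewrite normr0.
by move=> _ /= [u u1 <-]; exact: TM.
Qed.

Lemma operator_sphere_le1 {T : {linear X -> Y}} {v : X} :
  operator_sphere T -> `|v| <= 1 -> `|T v| <= 1.
Proof.
move=> [Tb T1] v1; have [M TM] := Tb 1.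
by rewrite -T1; apply: (opnorm_ub T M).
Qed.

(** Supplies the boundedness of [T \- F] that [opnorm_ub] asks for. *)
Lemma operator_sphere_subr_le2 {T F : {linear X -> Y}} {v : X} :
  operator_sphere T -> operator_sphere F -> `|v| <= 1 -> `|(T \- F) v| <= 2.
Proof.
move=> hT hF v1; apply: (le_trans (ler_normB _ _)).
by have := lerD (operator_sphere_le1 hT v1) (operator_sphere_le1 hF v1).
Qed.

Lemma operator_sphereP (T : {linear X -> Y}) (v : X) :
  (forall u, `|T u| <= `|u|) -> `|v| <= 1 -> `|T v| = 1 -> operator_sphere T.
Proof.
move=> Tle v1 Tv; have T1 u : `|u| <= 1 -> `|T u| <= 1 by exact: le_trans.
split; first by move=> r; exists r => u; exact: le_trans.
apply/eqP; rewrite eq_le (opnorm_le _ _ T1)/= -Tv.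
by apply: (opnorm_ub T 1).
Qed.

End OperatorNorm.

(** * Operators on the plane with the l1 norm, given by the images of the basis vectors *)

Section OperatorsFromEll1.
Context {R : realType}.

Definition vec2 (s t : R) : 'rV[R]_2 := \row_i (if i == 0 then s else t).

Lemma vec2_0 s t : vec2 s t 0 0 = s.
Proof. by rewrite mxE. Qed.

Lemma vec2_1 s t : vec2 s t 0 1 = t.
Proof. by rewrite mxE. Qed.

Definition vec2E := (vec2_0, vec2_1).

Lemma ell1_2_decomp (z : ell1_2 R) :
  z = z 0 0 *: (vec2 1 0 : ell1_2 R) + z 0 1 *: (vec2 0 1 : ell1_2 R).
Proof.
apply/eqP; rewrite -subr_eq0; apply/eqP/row2_eq0; rewrite !mxE /=; ring.
Qed.

Context {Y : normedModType R}.

Definition ell1_op (p q : Y) (v : ell1_2 R) : Y := v 0 0 *: p + v 0 1 *: q.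

Lemma ell1_op_linear p q : linear (ell1_op p q).
Proof.
move=> c u v; rewrite /ell1_op !mxE scalerDr !scalerDl !scalerA.
by rewrite addrACA.
Qed.

HB.instance Definition _ p q :=
  GRing.isLinear.Build R (ell1_2 R) Y _ (ell1_op p q) (ell1_op_linear p q).

Lemma ell1_op_e1 p q : ell1_op p q (vec2 1 0) = p.
Proof. by rewrite /ell1_op !vec2E scale1r scale0r addr0. Qed.

Lemma ell1_op_e2 p q : ell1_op p q (vec2 0 1) = q.
Proof. by rewrite /ell1_op !vec2E scale1r scale0r add0r. Qed.

Lemma norm_ell1_op_le p q v : `|p| <= 1 -> `|q| <= 1 -> `|ell1_op p q v| <= `|v|.
Proof.
move=> p1 q1; rewrite ell1_normE /ell1_norm (le_trans (ler_normD _ _))// !normrZ.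
by rewrite lerD// ler_piMr.
Qed.

Lemma norm_vec2 (s t : R) : `|vec2 s t : ell1_2 R| = `|s| + `|t|.
Proof. by rewrite ell1_normE /ell1_norm !vec2E. Qed.

Lemma norm_e1 : `|vec2 1 0 : ell1_2 R| = 1.
Proof. by rewrite norm_vec2 normr1 normr0 addr0. Qed.

Lemma norm_e2 : `|vec2 0 1 : ell1_2 R| = 1.
Proof. by rewrite norm_vec2 normr1 normr0 add0r. Qed.

Lemma ell1_op_sphere p q : `|p| = 1 -> `|q| <= 1 -> operator_sphere (ell1_op p q).
Proof.
move=> p1 q1; apply: (operator_sphereP (ell1_op p q) (vec2 1 0 : ell1_2 R)).
- by move=> u; apply: norm_ell1_op_le; rewrite ?p1.
- by rewrite norm_e1.
- by rewrite /= ell1_op_e1.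
Qed.

(** The coordinate [d / 2] is the threshold: moving on the unit sphere until the second coordinate
    vanishes costs [d / 2] in each coordinate, hence [d] in total, and the first coordinate is
    larger still. *)
Lemma ell1_near_pos (d : R) (z : ell1_2 R) : 0 < d < 1 ->
  `|z| = 1 -> `|(vec2 (1 - d / 2) (d / 2) : ell1_2 R) - z| < d ->
  [/\ 0 < z 0 0, 0 < z 0 1 & z 0 0 + z 0 1 = 1].
Proof.
move=> /andP[d0 d1]; rewrite !ell1_normE /ell1_norm !mxE /=.
move: (z 0 0) (z 0 1) => s t.
have [s0|s0] := ler0P s; have [t0|t0] := ler0P t => st;
have [u0|u0] := ler0P (1 - d / 2 - s); have [v0|v0] := ler0P (d / 2 - t) => h;
split; lra.
Qed.

End OperatorsFromEll1.

(** * Plane geometry of the hexagonal unit ball, in real coordinates *)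

Section Hexagon.
Context {R : realType}.

(** For [0 <= a < 1], each of the three linear forms equals 1 or -1 on one pair of opposite edges of
    the hexagon. *)
Definition hexnorm (a : R) (x y : R) : R :=
  Num.max `|x + a * y| (Num.max `|y + a * x| `|x - y|).

Lemma hexnorm_leP (a x y c : R) :
  (hexnorm a x y <= c) <->
  [/\ - c <= x + a * y <= c, - c <= y + a * x <= c & - c <= x - y <= c].
Proof.
rewrite /hexnorm !ge_max !ler_norml.
by split=> [/and3P[]|[-> -> ->]].
Qed.

Lemma hexnorm_ltP (a x y c : R) :
  (hexnorm a x y < c) <->
  [/\ - c < x + a * y < c, - c < y + a * x < c & - c < x - y < c].
Proof.
rewrite /hexnorm !gt_max !ltr_norml.
by split=> [/and3P[]|[-> -> ->]].
Qed.

(** The point is [(1 - d) (b, b) + d (0, 1)], rewritten using [d = b (1 + a) d]. *)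
Lemma far_edge_point {a b : R} (d : R) : b * (1 + a) = 1 ->
  let u := b * (1 - d) in let v := b * (1 + a * d) in
  [/\ u - v = - d, u + a * v = 1 - (1 - a) * d & v + a * u = 1].
Proof.
rewrite /= => ba; split.
- by transitivity (- d * (b * (1 + a))); [ring|rewrite ba; ring].
- transitivity (b * (1 + a) * (1 - (1 - a) * d)); first ring.
  by rewrite ba; ring.
- by transitivity (b * (1 + a)); [ring|rewrite ba].
Qed.

Lemma hexagon_no_common_edge (a b d p1 p2 q1 q2 s t : R) :
  0 <= a < 1 -> b * (1 + a) = 1 -> 0 < d < 1 -> 0 < s -> 0 < t -> s + t = 1 ->
  hexnorm a p1 p2 <= 1 -> hexnorm a q1 q2 <= 1 ->
  hexnorm a (s * p1 + t * q1) (s * p2 + t * q2) = 1 ->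
  hexnorm a (1 - p1) (0 - p2) < d ->
  hexnorm a (b * (1 - d) - q1) (b * (1 + a * d) - q2) < d -> False.
Proof.
move=> /andP[a0 a1] ba /andP[d0 d1] s0 t0 st.
move=> /hexnorm_leP[/andP[pf1 pf2] /andP[pg1 pg2] /andP[ph1 ph2]].
move=> /hexnorm_leP[/andP[qf1 qf2] /andP[qg1 qg2] /andP[qh1 qh2]] n1.
move=> /hexnorm_ltP[/andP[df1 df2] /andP[dg1 dg2] /andP[dh1 dh2]].
move=> /hexnorm_ltP[/andP[ef1 ef2] /andP[eg1 eg2] /andP[eh1 eh2]].
have [Th Tf Tg] := far_edge_point d ba.
(* The value 1 is extreme: a form that reaches it at a proper convex combination of two points of
   the ball reaches it at both, so they share an edge. *)
have ext (x y : R) : x <= 1 -> y <= 1 -> s * x + t * y = 1 -> x = 1 /\ y = 1.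
  move=> x1 y1 xy; split; nra.
have absE (x : R) : `|x| = 1 -> x = 1 \/ - x = 1.
  by case: (ler0P x); [right|left].
have : [\/ `|s * p1 + t * q1 + a * (s * p2 + t * q2)| = 1,
           `|s * p2 + t * q2 + a * (s * p1 + t * q1)| = 1 |
           `|s * p1 + t * q1 - (s * p2 + t * q2)| = 1].
  move: n1; rewrite /hexnorm maxEle; case: ifP => _; last by constructor 1.
  by rewrite maxEle; case: ifP => _; [constructor 3|constructor 2].
case=> /absE[] h.
- have [||//|x1 y1] := ext (p1 + a * p2) (q1 + a * q2); [lra|lra| |].
    by rewrite -h; ring.
  (* On this edge the second form is at most the first, so [q1 >= q2]; but [u - v = - d] and
     closeness give [q1 < q2]. *)
  have : 0 <= (1 - a) * (q1 - q2) by lra.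
  rewrite pmulr_rge0; lra.
- have [||//|x1 y1] := ext (- (p1 + a * p2)) (- (q1 + a * q2)); [lra|lra| |].
    by rewrite -h; ring.
  lra.
- have [||//|x1 y1] := ext (p2 + a * p1) (q2 + a * q1); [lra|lra| |].
    by rewrite -h; ring.
  (* Symmetrically [p2 >= p1] on this edge, whereas a point closer than [d < 1] to [(1, 0)] has
     [p1 > p2]. *)
  have : 0 <= (1 - a) * (p2 - p1) by lra.
  rewrite pmulr_rge0; lra.
- have [||//|x1 y1] := ext (- (p2 + a * p1)) (- (q2 + a * q1)); [lra|lra| |].
    by rewrite -h; ring.
  lra.
- have [||//|x1 y1] := ext (p1 - p2) (q1 - q2); [lra|lra| |].
    by rewrite -h; ring.
  lra.
- have [||//|x1 y1] := ext (p2 - p1) (q2 - q1); [lra|lra| |].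
    by rewrite -h; ring.
  lra.
Qed.

End Hexagon.

(** * The extremal operator and the lower bound for the modulus *)

Section LowerBound.
Context {R : realType} {rho : R} (rho_itv : 2^-1 <= rho < 1).
Notation Y := (Yrho rho_itv).
Notation a := (2 - rho^-1).

Lemma Yrho_hexnorm (y : Y) : `|y| = hexnorm a (y 0 0) (y 0 1).
Proof. by []. Qed.

Lemma coef_itv : 0 <= a < 1.
Proof.
have /andP[r1 r2] := rho_itv; have r0 : 0 < rho by lra.
have rV : rho^-1 * rho = 1 by rewrite mulVf// gt_eqF.
have rV0 : 0 < rho^-1 by rewrite invr_gt0.
by apply/andP; split; nra.
Qed.

Lemma norm_Yrho_e1 : `|vec2 1 0 : Y| = 1.
Proof.
have /andP[a0 a1] := coef_itv.
rewrite Yrho_hexnorm !vec2E /hexnorm mulr0 mulr1 addr0 add0r subr0 normr1.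
by rewrite ger0_norm// (max_r (ltW a1)) maxxx.
Qed.

Lemma unattained_near (d : R) : 0 < d < 1 ->
  exists T : {linear ell1_2 R -> Y},
    let x : ell1_2 R := vec2 (1 - d / 2) (d / 2) in
    [/\ operator_sphere T, 1 - (1 - a) * d ^+ 2 / 2 <= `|T x| &
      forall (z : ell1_2 R) (F : {linear ell1_2 R -> Y}),
        unit_sphere z -> operator_sphere F -> `|F z| = 1 -> `|x - z| < d ->
        opnorm (T \- F) < d -> False].
Proof.
move=> d01; have /andP[d0 d1] := d01; have a01 := coef_itv.
have /andP[a0 a1] := a01.
pose b := (1 + a)^-1.
have ba : b * (1 + a) = 1 by rewrite mulVf// gt_eqF//; lra.
pose q : Y := vec2 (b * (1 - d)) (b * (1 + a * d)).
have [Th Tf Tg] := far_edge_point d ba.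
have q1 : `|q| <= 1.
  rewrite Yrho_hexnorm !vec2E; apply/hexnorm_leP.
  rewrite Th Tf Tg; split; apply/andP; split; nra.
exists (ell1_op (vec2 1 0 : Y) q) => x; split.
- exact: ell1_op_sphere norm_Yrho_e1 q1.
(* The first form alone suffices: at [T x] it equals [(1 - d/2) + (d/2) (1 - (1 - a) d)]. *)
- rewrite Yrho_hexnorm /hexnorm le_max; apply/orP; left.
  rewrite /= /ell1_op !mxE /=.
  rewrite (le_trans _ (ler_norm _))//.
  rewrite le_eqVlt; apply/orP; left; apply/eqP.
  transitivity
    ((1 - d / 2) + d / 2 * (b * (1 - d) + a * (b * (1 + a * d)))); last ring.
  by rewrite Tf; ring.
- move=> z F z1 Fs Fz xz TF.
  have Ts := ell1_op_sphere _ _ norm_Yrho_e1 q1.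
  have TFlt (v : ell1_2 R) : `|v| = 1 -> `|ell1_op (vec2 1 0 : Y) q v - F v| < d.
    move=> v1; apply: le_lt_trans TF.
    apply: (opnorm_ub (ell1_op (vec2 1 0 : Y) q \- F) 2); last by rewrite v1.
    by move=> u u1; exact: (operator_sphere_subr_le2 Ts Fs u1).
  have [z0p z1p zs] := ell1_near_pos d z d01 z1 xz.
  have F1 (v : ell1_2 R) : `|v| = 1 -> `|F v| <= 1.
    by move=> v1; apply: (operator_sphere_le1 Fs); rewrite v1.
  have := TFlt _ norm_e1; have := TFlt _ norm_e2.
  rewrite ell1_op_e1 ell1_op_e2.
  have := F1 _ norm_e1; have := F1 _ norm_e2; move: Fz.
  rewrite {1}(ell1_2_decomp z) linearD !linearZ /=.
  move: (F _) (F _) => p p'.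
  rewrite !Yrho_hexnorm !mxE /= => h1 h2 h3 h4 h5.
  exact: (hexagon_no_common_edge a b d _ _ _ _ _ _
            a01 ba d01 z0p z1p zs h3 h2 h1 h5 h4).
Qed.

End LowerBound.

Theorem theorem3p6 (R : realType) (rho eps : R) (rho_itv : 2^-1 <= rho < 1)
    (eps_itv : 0 < eps < 1) :
  spherical_BPB_modulus (ell1_2 R) (Yrho rho_itv) eps >=
  Num.min (Num.sqrt (2 * rho * eps / (1 - rho))) 1.
Proof.
have /andP[e0 e1] := eps_itv; have /andP[r1 r2] := rho_itv.
have a01 := coef_itv rho_itv.
have r0 : 0 < rho by lra.
apply: lb_le_inf.
  (* [lb_le_inf] requires a member of the set; 3 exceeds 2, the largest distance between unit
     vectors or between operators of norm 1. *)
  exists 3; split=> // x T x1 Ts _.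
  have Fs : operator_sphere (ell1_op (vec2 1 0 : Yrho rho_itv) 0).
    by apply: ell1_op_sphere; rewrite ?normr0// norm_Yrho_e1.
  exists (vec2 1 0), (ell1_op (vec2 1 0 : Yrho rho_itv) 0); split => //.
  - exact: norm_e1.
  - by rewrite /= ell1_op_e1 norm_Yrho_e1.
  - rewrite (le_lt_trans (ler_normB _ _))// x1 norm_e1; lra.
  - apply: (@le_lt_trans _ _ 2); last lra.
    by apply: opnorm_le => u u1; exact: (operator_sphere_subr_le2 Ts Fs u1).
move=> d /= [d0 dP]; rewrite leNgt; apply/negP; rewrite lt_min => /andP[ds d1].
have [|T [Ts Tx noF]] := unattained_near rho_itv d; first by rewrite d0.
have [||z [F [z1 Fs Fz xz TF]]] := dP (vec2 (1 - d / 2) (d / 2)) T _ Ts.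
- by rewrite /unit_sphere/= norm_vec2 !ger0_norm; lra.
- apply: lt_le_trans Tx; rewrite ltrD2l ltrN2.
  (* Since [1 - a = (1 - rho) / rho], this says that the loss [(1 - a) d^2 / 2] is less than
     [eps]. *)
  have : d ^+ 2 < 2 * rho * eps / (1 - rho).
    rewrite -(@sqr_sqrtr _ (2 * rho * eps / (1 - rho))).
      by rewrite ltr_pXn2r// nnegrE ?sqrtr_ge0// ltW.
    by rewrite divr_ge0 ?mulr_ge0; lra.
  rewrite ltr_pdivlMr ?subr_gt0// => dlt.
  rewrite -(ltr_pM2l r0).
  have -> : rho * ((1 - (2 - rho^-1)) * d ^+ 2 / 2) = d ^+ 2 * (1 - rho) / 2.
    by field; rewrite gt_eqF.
  lra.
- exact: noF z F z1 Fs Fz xz TF.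
Qed.
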